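(* For any finite connected graph $G$ of order $n\geq 3$, with $\ell$ pendant vertices and $s$ support vertices, $$\rho(G)\leq \frac{n-\ell+\delta' s}{1+\delta'},$$ where $\delta'$ is the minimum degree taken over all vertices of $G$ that are not pendant vertices.
   Context: Graphs are simple and undirected. The order of $G$ is $|V(G)|$. A pendant vertex is a vertex of degree $1$, and a support vertex is a vertex having at least one pendant vertex in its neighborhood. For a vertex $v$, $N[v]$ denotes its closed neighborhood ($v$ together with all its neighbors). A subset $B\subseteq V(G)$ is a packing in $G$ if $|N[v]\cap B|\leq 1$ for all $v\in V(G)$ (equivalently, $N[u]\cap N[v]=\emptyset$ for all distinct $u,v\in B$). The packing number $\rho(G)$ is the maximum cardinality of a packing in $G$. *)

(* Defs.v *)
From mathcomp Require Import all_boot all_order all_algebra.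
Set Implicit Arguments.
Unset Strict Implicit.
Unset Printing Implicit Defensive.

(* A finite simple graph is a symmetric irreflexive adjacency relation e on a
   finite type T of vertices. *)

Definition simple_graph (T : finType) (e : rel T) : Prop :=
  symmetric e /\ irreflexive e.

(* Since there is no nonemptiness requirement here, the graph without vertices
   counts as connected. *)
Definition connected_graph (T : finType) (e : rel T) : Prop :=
  forall u v : T, connect e u v.

Definition open_nbhd (T : finType) (e : rel T) (v : T) : {set T} :=
  [set u | e v u].

Definition closed_nbhd (T : finType) (e : rel T) (v : T) : {set T} :=
  v |: open_nbhd e v.

Definition degree (T : finType) (e : rel T) (v : T) : nat :=
  #|open_nbhd e v|.

Definition pendant_vertices (T : finType) (e : rel T) : {set T} :=
  [set v | degree e v == 1].

Definition support_vertices (T : finType) (e : rel T) : {set T} :=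
  [set v | [exists u in open_nbhd e v, u \in pendant_vertices e]].

(* The default value #|T| exceeds every degree of a simple graph, so it never
   affects the minimum as long as some vertex is not pendant. *)
Definition min_nonpendant_degree (T : finType) (e : rel T) : nat :=
  \big[minn/#|T|]_(v in ~: pendant_vertices e) degree e v.

Definition packing (T : finType) (e : rel T) (B : {set T}) : bool :=
  [forall v, #|closed_nbhd e v :&: B| <= 1].

Definition packing_number (T : finType) (e : rel T) : nat :=
  \max_(B : {set T} | packing e B) #|B|.

(* Main.v *)
Require Import Defs.
From mathcomp Require Import all_boot all_order all_algebra.
Import Order.TTheory GRing.Theory Num.Theory.
Local Open Scope ring_scope.

(* Let d be the minimum degree of a non-pendant vertex. Give each non-pendant
   vertex weight 1 and each support vertex an additional weight d.
   Every closed neighbourhood then has weight at least 1 + d: either it contains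
   a support vertex, which is not pendant because the graph is connected of order
   at least 3, or it consists of at least 1 + d non-pendant vertices.
   Closed neighbourhoods of the vertices of a packing are disjoint, so their
   number times 1 + d is at most the total weight, (n - l) + d s. *)

Section Graph.

Set Implicit Arguments.
Unset Strict Implicit.

Context {T : finType} {e : rel T}.
Local Open Scope nat_scope.

Lemma min_nonpendant_degree_le (v : T) :
  v \notin pendant_vertices e -> min_nonpendant_degree e <= degree e v.
Proof.
move=> v_np; rewrite /min_nonpendant_degree.
(* The default [#|T|] is not neutral for [minn] on [nat], so the bound goes by induction over an
   arbitrary list containing [v]. *)
elim: (index_enum T) (mem_index_enum v) => // x r IHr.
rewrite inE big_cons => /predU1P[<-|/IHr le_r]; first by rewrite inE v_np geq_minl.
by case: ifP => // _; rewrite geq_min le_r orbT.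
Qed.

Lemma pendantP (u v w : T) :
  u \in pendant_vertices e -> e u v -> e u w -> v = w.
Proof.
rewrite inE => /cards1P[x Nu] uv uw.
have [] : v \in open_nbhd e u /\ w \in open_nbhd e u by rewrite !inE.
by rewrite Nu !inE => /eqP-> /eqP->.
Qed.

Context (simple_e : simple_graph e).

Lemma mem_closed_nbhdC (u v : T) :
  (u \in closed_nbhd e v) = (v \in closed_nbhd e u).
Proof. by rewrite !inE eq_sym (proj1 simple_e). Qed.

Lemma card_closed_nbhd (v : T) : #|closed_nbhd e v| = (degree e v).+1.
Proof. by rewrite cardsU1 inE (proj2 simple_e). Qed.

(** Two adjacent pendant vertices have no further neighbours, so they would form a whole component,
    and by connectedness the graph would have order at most 2. *)
Lemma pendant_nbr_nonpendant (u v : T) :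
    connected_graph e -> 3 <= #|T| -> u \in pendant_vertices e -> e u v ->
  v \notin pendant_vertices e.
Proof.
move=> conn_e n_ge3 u_p uv; apply/negP => v_p; have [sym_e _] := simple_e.
have clos : closed e [set u; v].
  apply: (intro_closed (sym_connect_sym sym_e)) => x y xy.
  rewrite !inE => /orP[] /eqP x_eq; rewrite x_eq in xy.
    by rewrite (pendantP u_p xy uv) eqxx orbT.
  by rewrite sym_e in uv; rewrite (pendantP v_p xy uv) eqxx.
suff: #|T| <= 2 by rewrite leqNgt n_ge3.
apply: leq_trans (_ : #|[set u; v]| <= 2); last by rewrite cards2; case: eqP.
rewrite -cardsT; apply/subset_leq_card/subsetP => x _.
by rewrite -(closed_connect clos (conn_e u x)) !inE eqxx.
Qed.

Lemma support_nonpendant (v : T) :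
    connected_graph e -> 3 <= #|T| ->
  v \in support_vertices e -> v \notin pendant_vertices e.
Proof.
move=> conn_e n_ge3; rewrite inE => /exists_inP[u]; rewrite inE => vu u_p.
by apply: pendant_nbr_nonpendant conn_e n_ge3 u_p _; rewrite (proj1 simple_e).
Qed.

Definition packing_weight (v : T) : nat :=
  (v \notin pendant_vertices e)
    + min_nonpendant_degree e * (v \in support_vertices e).

Lemma sum_packing_weight :
  \sum_v packing_weight v =
    #|~: pendant_vertices e| + min_nonpendant_degree e * #|support_vertices e|.
Proof.
rewrite big_split -big_distrr /= -!sum1_card.
by congr (_ + _ * _); rewrite [RHS]big_mkcond; apply: eq_bigr => v _;
  rewrite ?inE; case: ifP.
Qed.

Lemma closed_nbhd_weight (b : T) :
    connected_graph e -> 3 <= #|T| ->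
  (min_nonpendant_degree e).+1 <= \sum_(v in closed_nbhd e b) packing_weight v.
Proof.
move=> conn_e n_ge3; have [sym_e _] := simple_e.
case: (boolP [exists v in closed_nbhd e b, v \in support_vertices e]).
  move=> /exists_inP[v vNb v_s]; rewrite (bigD1 v) //= {1}/packing_weight.
  by rewrite v_s (support_nonpendant conn_e n_ge3 v_s) muln1 add1n leq_addr.
rewrite negb_exists_in => /forall_inP Nb_ns.
have b_ns : b \notin support_vertices e by apply: Nb_ns; rewrite !inE eqxx.
(* The neighbour of a pendant [b] would be a support vertex in the closed neighbourhood of [b]. *)
have b_np : b \notin pendant_vertices e.
  apply/negP => b_p; have : 0 < degree e b by move: b_p; rewrite inE => /eqP->.
  case/card_gt0P=> v; rewrite inE => bv.
  have /Nb_ns/negP[] : v \in closed_nbhd e b by rewrite !inE bv orbT.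
  by rewrite inE; apply/exists_inP; exists b => //; rewrite inE sym_e.
apply: (@leq_trans #|closed_nbhd e b|).
  by rewrite card_closed_nbhd ltnS min_nonpendant_degree_le.
(* Each vertex here has weight at least 1: a pendant neighbour of [b] would make [b] a support
   vertex. *)
rewrite -sum1_card; apply: leq_sum => v; rewrite /packing_weight !inE.
case/predU1P=> [->|bv]; first by move: b_np; rewrite inE => ->.
suff: v \notin pendant_vertices e by rewrite inE => ->.
apply: contra b_ns => v_p; rewrite inE; apply/exists_inP.
by exists v => //; rewrite inE.
Qed.

(** After exchanging the sums, [w v] is counted once for each [b] in [B] whose closed neighbourhood
    contains [v]. By symmetry these [b] lie in the closed neighbourhood of [v], which meets [B] at
    most once. *)
Lemma packing_sum_le (B : {set T}) (w : T -> nat) :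
  packing e B -> \sum_(b in B) \sum_(v in closed_nbhd e b) w v <= \sum_v w v.
Proof.
move=> /forallP packB; rewrite (exchange_big_dep predT) //=.
apply: leq_sum => v _; rewrite sum_nat_const -{2}[w v]mul1n leq_mul2r.
apply/orP; right; apply: leq_trans (packB v); apply/subset_leq_card/subsetP => b.
by rewrite unfold_in mem_closed_nbhdC => bBv; rewrite inE andbC.
Qed.

Lemma packing_number_mul_le :
    connected_graph e -> 3 <= #|T| ->
  packing_number e * (min_nonpendant_degree e).+1 <=
    #|~: pendant_vertices e| + min_nonpendant_degree e * #|support_vertices e|.
Proof.
move=> conn_e n_ge3; rewrite -sum_packing_weight.
(* The empty packing ensures that the maximum is attained by some packing [B]. *)
have pack0 : packing e set0 by apply/forallP => v; rewrite setI0 cards0.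
rewrite /packing_number (bigop.bigmax_eq_arg _ pack0) //.
case: arg_maxnP => // B packB _.
apply: leq_trans (packing_sum_le packing_weight packB); rewrite -sum_nat_const.
by apply: leq_sum => b _; apply: closed_nbhd_weight.
Qed.

End Graph.

Theorem theorem4p1 (T : finType) (e : rel T)
    (simple_e : simple_graph e) (connected_e : connected_graph e)
    (order_ge3 : (3 <= #|T|)%N) :
  let n : rat := #|T|%:R in
  let l : rat := #|pendant_vertices e|%:R in
  let s : rat := #|support_vertices e|%:R in
  let delta' : rat := (min_nonpendant_degree e)%:R in
  (packing_number e)%:R <= (n - l + delta' * s) / (1 + delta').
Proof.
cbv zeta; rewrite ler_pdivlMr ?nat1r ?ltr0n // -natrM.
(* Splitting [n] into pendant and non-pendant vertices cancels [l], which leaves an inequality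
   between natural numbers. *)
rewrite -(cardsC (pendant_vertices e)) natrD [_ + _ - _]addrAC subrr add0r.
by rewrite -natrM -natrD ler_nat packing_number_mul_le.
Qed.
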